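(* Assume the Exponential Time Hypothesis: there exists $\delta>0$ such that no algorithm solves $3$-SAT in $O(2^{\delta n})$ time, where $n$ is the number of variables. Then there exists $\epsilon_0>0$ such that for all $\epsilon\le\epsilon_0$ there is no polynomial-time algorithm for $3$-SAT given subset advice where each variable is included with probability $\epsilon$.
   Context: $3$-SAT: given a CNF formula in which each clause has at most $3$ literals, decide whether it is satisfiable. Subset advice with parameter $\epsilon$: a subset $S\subseteq\{1,\dots,n\}$ of variable indices, each included independently with probability $\epsilon$, together with the values $\{x^*_i\}_{i\in S}$ of a fixed satisfying assignment $x^*$. *)

(* Defs.v *)
From mathcomp Require Import all_boot all_order all_algebra.
From mathcomp Require Import boolp reals exp.

Set Implicit Arguments.
Unset Strict Implicit.
Unset Printing Implicit Defensive.

Import Order.TTheory GRing.Theory Num.Theory.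
Local Open Scope ring_scope.

(** * 3-SAT *)

(* [(i, b)] is the variable [i] if [b] is true and its negation otherwise. *)
Definition literal (n : nat) : Type := ('I_n * bool)%type.
Definition clause (n : nat) : Type := seq (literal n).
Definition cnf (n : nat) : Type := seq (clause n).
Definition assignment (n : nat) : Type := {ffun 'I_n -> bool}.

(* A formula is a set of clauses: no clause is listed twice. Otherwise its
   length would not be bounded in terms of the number [n] of variables, no
   algorithm could even read its input in time depending on [n] only, and the
   Exponential Time Hypothesis below would hold for a trivial reason. *)
Definition is_3cnf (n : nat) (phi : cnf n) : bool :=
  uniq phi && all (fun c : clause n => (size c <= 3)%N) phi.

Definition satisfies (n : nat) (x : assignment n) (phi : cnf n) : bool :=
  all (fun c : clause n => has (fun l : literal n => x l.1 == l.2) c) phi.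

Definition satisfiable (n : nat) (phi : cnf n) : bool :=
  [exists x : {ffun 'I_n -> bool}, satisfies x phi].

(** * Encoding of instances as words *)

Inductive symbol : Type :=
  | Tick
  | NewClause
  | Sign of bool
  | Advice of option bool.

Definition encode_literal (n : nat) (l : literal n) : seq symbol :=
  Sign l.2 :: nseq l.1 Tick.

Definition encode_clause (n : nat) (c : clause n) : seq symbol :=
  NewClause :: flatten [seq encode_literal l | l <- c].

(* The number of variables is written in unary, so that the length of an
   instance is at least [n]; writing the variable indices in unary as well then
   changes the length of an instance at most polynomially. *)
Definition encode_cnf (n : nat) (phi : cnf n) : seq symbol :=
  nseq n Tick ++ flatten [seq encode_clause c | c <- phi].

(* The pair (S, x restricted to S): one letter per variable, which is the value
   of the variable if it belongs to [S], and [None] if it does not. *)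
Definition encode_advice (n : nat) (S : {set 'I_n}) (x : assignment n) :
    seq symbol :=
  [seq Advice (if i \in S then Some (x i) else None) | i <- enum 'I_n].

(** * Deterministic multitape Turing machines *)

Inductive move : Type := MoveLeft | Stay | MoveRight.

(* [verdict q] is [None] if the machine goes on from state [q], and [Some b] if
   it halts in state [q] with answer [b]. *)
Record TM : Type := MkTM {
  state : finType;
  start : state;
  verdict : state -> option bool;
  tape_index : finType;
  input_tape : tape_index;
  tape_symbol : finType;
  blank : tape_symbol;
  letter : symbol -> tape_symbol;
  letter_inj : injective letter;
  letter_not_blank : forall a : symbol, letter a != blank;
  transition : state -> {ffun tape_index -> tape_symbol} ->
               state * {ffun tape_index -> tape_symbol * move}
}.

(* A two-way infinite tape; [on_left] and [on_right] are listed from the head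
   outwards, and every cell beyond them is blank. *)
Record tape (A : Type) : Type := Tape {
  on_left : seq A;
  under_head : A;
  on_right : seq A
}.

Definition load_tape (A : Type) (b : A) (w : seq A) : tape A :=
  Tape [::] (head b w) (behead w).

(* Write [am.1] under the head, then move the head according to [am.2]. *)
Definition act_tape (A : Type) (b : A) (am : A * move) (t : tape A) : tape A :=
  match am.2 with
  | MoveLeft => Tape (behead (on_left t)) (head b (on_left t))
                     (am.1 :: on_right t)
  | Stay => Tape (on_left t) am.1 (on_right t)
  | MoveRight => Tape (am.1 :: on_left t) (head b (on_right t))
                      (behead (on_right t))
  end.

Record config (M : TM) : Type := Config {
  cur_state : state M;
  cur_tapes : {ffun tape_index M -> tape (tape_symbol M)}
}.

Definition init_config (M : TM) (w : seq symbol) : config M :=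
  Config (start M)
    [ffun i => load_tape (blank M)
                 (if i == input_tape M then map (@letter M) w else [::])].

Definition step (M : TM) (c : config M) : config M :=
  if verdict (cur_state c) is Some _ then c else
  let qa := transition (cur_state c) [ffun i => under_head (cur_tapes c i)] in
  Config qa.1 [ffun i => act_tape (blank M) (qa.2 i) (cur_tapes c i)].

(* [Some b] if on input [w] the machine halts with answer [b] after at most [t]
   steps, [None] if it is still running. *)
Definition answer_within (M : TM) (w : seq symbol) (t : nat) : option bool :=
  verdict (cur_state (iter t (@step M) (init_config M w))).

Definition accepts (M : TM) (w : seq symbol) : Prop :=
  exists t : nat, answer_within M w t = Some true.

Definition rejects (M : TM) (w : seq symbol) : Prop :=
  exists t : nat, answer_within M w t = Some false.

Definition polynomial_time (M : TM) : Prop :=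
  exists c k : nat, forall w : seq symbol,
    answer_within M w (c * (size w).+1 ^ k)%N <> None.

(** * Exponential Time Hypothesis *)

Definition solves_3sat_in_exp_time (R : realType) (delta : R) (M : TM) : Prop :=
  exists C : R, forall (n : nat) (phi : cnf n), is_3cnf phi ->
    exists t : nat, t%:R <= C * 2 `^ (delta * n%:R) /\
      answer_within M (encode_cnf phi) t = Some (satisfiable phi).

Definition ETH (R : realType) : Prop :=
  exists delta : R, 0 < delta /\
    ~ exists M : TM, solves_3sat_in_exp_time delta M.

(** * Subset advice *)

(* The probability that a random subset of the variables, containing each
   variable independently with probability [eps], satisfies [E]. *)
Definition subset_prob (R : realType) (eps : R) (n : nat)
    (E : {set 'I_n} -> Prop) : R :=
  \sum_(S : {set 'I_n} | `[< E S >])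
    \prod_(i < n) (if i \in S then eps else 1 - eps).

(* The only randomness is that of the subset. An unsatisfiable formula has no
   assignment from which genuine advice could be drawn; it has to be rejected
   whatever the alleged advice is. Without such a requirement the machine which
   always accepts would do. *)
Definition solves_3sat_with_subset_advice (R : realType) (eps p : R) (M : TM) :
    Prop :=
  forall (n : nat) (phi : cnf n), is_3cnf phi ->
    (forall x : assignment n, satisfies x phi ->
       p <= subset_prob eps (fun S : {set 'I_n} =>
              accepts M (encode_cnf phi ++ encode_advice S x))) /\
    (~~ satisfiable phi -> forall (S : {set 'I_n}) (x : assignment n),
       rejects M (encode_cnf phi ++ encode_advice S x)).

(* Main.v *)
Require Import Defs.
From HB Require Import structures.
From mathcomp Require Import all_boot all_order all_algebra.
From mathcomp Require Import boolp reals exp.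
From mathcomp Require Import zify ring lra.

Set Implicit Arguments.
Unset Strict Implicit.
Unset Printing Implicit Defensive.

Import Order.TTheory GRing.Theory Num.Theory.
Local Open Scope ring_scope.

(** From a polynomial-time machine [M] using subset advice, build a machine that
    solves 3-SAT without advice: run [M] on every advice string that reveals at
    most [m] variables, and accept as soon as one run accepts. With
    [m = N0 + ceil(n / (q + 1))], the expectation of [2 ^ |S|], which is
    [(1 + eps) ^ n], shows that a random [S] has more than [m] elements with
    probability at most [2 ^ - N0 < p], so that some successful [S] is tried
    whenever the formula is satisfiable. The number of advice strings tried is at
    most [2 ^ (r m) * (1 + 2 / 2 ^ r) ^ n] for every [r], hence is
    [O(2 ^ (delta n / 2))] for a suitable [r] and then a large [q]; only [N0]
    depends on [p].

    Between two runs the tapes of [M] have to be restored. The search machine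
    records on a history tape the state and the symbols read at each step of [M],
    and then undoes the steps one by one; the advice is afterwards still at the
    end of the input and is modified in place. *)

(** * Tapes with absolute positions *)

Section Tapes.
Context {A : Type}.
Implicit Types (b a : A) (t : tape A) (f : int -> A).

(* The contents of the cells and the position of the head. *)
Definition head_tape (B : Type) : Type := ((int -> B) * int)%type.
Implicit Types (X : head_tape A).

Definition upd (p : int) a f : int -> A := fun z => if z == p then a else f z.

Definition shift (m : move) : int :=
  match m with MoveLeft => -1 | Stay => 0 | MoveRight => 1 end.

Definition act (am : A * move) X : head_tape A :=
  (upd X.2 am.1 X.1, X.2 + shift am.2).

Definition read X : A := X.1 X.2.

Definition cell b t (z : int) : A :=
  match z with
  | Posz 0 => under_head t
  | Posz n.+1 => nth b (on_right t) n
  | Negz n => nth b (on_left t) n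
  end.

(** Cells beyond the stored lists count as blanks, so lists that differ by trailing blanks denote
    the same tape. Undoing a step can thus restore the contents exactly even if the lists have
    grown. *)
Definition denotes b t X : Prop := forall z, cell b t z = X.1 (X.2 + z).

Lemma denotes_read b t X : denotes b t X -> under_head t = read X.
Proof. by move=> /(_ 0) /=; rewrite addr0. Qed.

Lemma cell_act b am t z :
  cell b (act_tape b am t) z =
  if z + shift am.2 == 0 then am.1 else cell b t (z + shift am.2).
Proof.
case: am => a m; rewrite [_.1]/= [_.2]/=; move e : (z + shift m) => y.
case: m e => /= e; case: z e => [[|[|n]]|[|n]] e.
- have -> : y = Negz 0 by lia.
  by rewrite /= nth0.
- by have -> : y = 0 by lia.
- by have -> : y = Posz n.+1 by lia.
- have -> : y = Negz 1 by lia.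
  by rewrite /= nth_behead.
- have -> : y = Negz n.+2 by lia.
  by rewrite /= nth_behead.
- by have -> : y = 0 by lia.
- by have -> : y = 1 by lia.
- by have -> : y = Posz n.+2 by lia.
- by have -> : y = Negz 0 by lia.
- by have -> : y = Negz n.+1 by lia.
- have -> : y = 1 by lia.
  by rewrite /= nth0.
- have -> : y = 2 by lia.
  by rewrite /= nth_behead.
- have -> : y = Posz n.+3 by lia.
  by rewrite /= nth_behead.
- by have -> : y = 0 by lia.
- by have -> : y = Negz n by lia.
Qed.

Lemma denotes_act b am t X :
  denotes b t X -> denotes b (act_tape b am t) (act am X).
Proof.
move=> tX z; rewrite cell_act /act /upd /= tX.
have -> : (X.2 + shift am.2 + z == X.2) = (z + shift am.2 == 0) by lia.
by rewrite -addrA [z + _]addrC.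
Qed.

Lemma upd_id p f : upd p (f p) f = f.
Proof. by apply/funext => z; rewrite /upd; case: eqP => // ->. Qed.

Lemma act_stay X : act (read X, Stay) X = X.
Proof. by case: X => f p; rewrite /act /read /= upd_id addr0. Qed.

Lemma act_keep m X : act (read X, m) X = (X.1, X.2 + shift m).
Proof. by case: X => f p; rewrite /act /read /= upd_id. Qed.

Definition back (m : move) : move :=
  match m with MoveLeft => MoveRight | Stay => Stay | MoveRight => MoveLeft end.

(** The overwritten symbol belongs to the cell that the head has left, so the head moves back first
    and writes afterwards; this takes two actions. *)
Lemma undo_act a m X :
  act (read X, Stay) (act (read (act (a, m) X), back m) (act (a, m) X)) = X.
Proof.
rewrite act_keep /act /=; case: X => f p; congr pair; last by case: m => /=; lia.
apply/funext => z; rewrite /upd /read /=.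
have -> : p + shift m + shift (back m) = p by case: m => /=; lia.
by case: eqP => // ->.
Qed.

Definition word_cells b (w : seq A) (z : int) : A :=
  if z is Posz n then nth b w n else b.

Lemma upd_word_cells b u a a' v :
  upd (size u) a (word_cells b (u ++ a' :: v)) = word_cells b (u ++ a :: v).
Proof.
apply/funext => -[n|n] //; rewrite /upd /=.
have -> : (Posz n == size u) = (n == size u) by lia.
case: eqP => [->|ne]; first by rewrite nth_cat ltnn subnn.
rewrite !nth_cat; case: ltnP => // le.
by have -> : (n - size u = (n - size u).-1.+1)%N by lia.
Qed.

Lemma upd_word_cells_end b u a :
  upd (size u) a (word_cells b u) = word_cells b (rcons u a).
Proof.
apply/funext => -[n|n] //; rewrite /upd /= nth_rcons.
have -> : (Posz n == size u) = (n == size u) by lia.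
case: ltnP => [lt|le]; case: eqP => // e; first by lia.
by rewrite nth_default.
Qed.

Lemma word_cells_nil b : word_cells b [::] = fun=> b.
Proof. by apply/funext => -[n|n] //=; rewrite nth_nil. Qed.

Lemma denotes_load b w : denotes b (load_tape b w) (word_cells b w, 0).
Proof.
move=> z; rewrite /= add0r; case: z => [[|n]|n] /=.
- by case: w.
- by rewrite nth_behead.
- by rewrite nth_nil.
Qed.

Definition pile b a (k : nat) : int -> A := word_cells b (nseq k a).

Lemma pileE b a k z : pile b a k z = if (0 <= z) && (z < k%:Z) then a else b.
Proof.
case: z => [n|n] //=; rewrite /pile /= nth_nseq.
by have -> : (Posz n < k) = (n < k)%N by lia.
Qed.

Lemma upd_pile b a (k : nat) : upd k a (pile b a k) = pile b a k.+1.
Proof.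
apply/funext => z; rewrite /upd !pileE.
by case: eqP => ?; repeat case: ifP => ? //; lia.
Qed.

Lemma upd_pile_pop b a (k : nat) : upd k b (pile b a k.+1) = pile b a k.
Proof.
apply/funext => z; rewrite /upd !pileE.
by case: eqP => ?; repeat case: ifP => ? //; lia.
Qed.

End Tapes.
Arguments read : simpl never.
Arguments act : simpl never.

(** * The search machine *)

Section Control.
Context (N0 q : nat).

Inductive control (Q : Type) : Type :=
  | Init of 'I_N0.+1
  | Count of 'I_q.+1
  | Skip
  | Fill
  | Return
  | Run of Q
  | Undo1
  | Undo2
  | Undo3
  | Walk
  | Next
  | Fail.

Definition control_code (Q : Type) (s : control Q) :
    ('I_N0.+1 + 'I_q.+1) + (Q + 'I_9) :=
  match s with
  | Init k => inl (inl k)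
  | Count k => inl (inr k)
  | Run x => inr (inl x)
  | Skip => inr (inr (inord 0))
  | Fill => inr (inr (inord 1))
  | Return => inr (inr (inord 2))
  | Undo1 => inr (inr (inord 3))
  | Undo2 => inr (inr (inord 4))
  | Undo3 => inr (inr (inord 5))
  | Walk => inr (inr (inord 6))
  | Next => inr (inr (inord 7))
  | Fail => inr (inr (inord 8))
  end.

(** [Fail] has code 8, one past the end of the list, and is recovered as the default of [nth]. *)
Definition control_decode (Q : Type) (c : ('I_N0.+1 + 'I_q.+1) + (Q + 'I_9)) :
    control Q :=
  match c with
  | inl (inl k) => Init Q k
  | inl (inr k) => Count Q k
  | inr (inl x) => Run x
  | inr (inr k) => nth (Fail Q) [:: Skip Q; Fill Q; Return Q; Undo1 Q; Undo2 Q;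
                                     Undo3 Q; Walk Q; Next Q] k
  end.

Lemma control_codeK (Q : Type) : cancel (@control_code Q) (@control_decode Q).
Proof. by case=> //=; rewrite inordK. Qed.

HB.instance Definition _ (Q : finType) :=
  Finite.copy (control Q) (can_type (@control_codeK Q)).

End Control.

Section Search.
Context (M : TM) (N0 q : nat).

Local Notation Q := (state M).
Local Notation I := (tape_index M).
Local Notation i0 := (input_tape M).
Local Notation A := (tape_symbol M).
Local Notation bl := (blank M).

(** An entry determines the transition taken, hence the head moves, and it contains the symbols
    overwritten: enough to undo the step. *)
Definition hist : Type := (Q * {ffun I -> A})%type.
Definition sym : Type := (A + hist)%type.
HB.instance Definition _ := Finite.on sym.

Definition sym_letter (a : symbol) : sym := inl (letter M a).
Definition sym_blank : sym := inl bl.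
Definition tick : sym := sym_letter Tick.

Lemma sym_letter_inj : injective sym_letter.
Proof. by move=> a b [] /(@letter_inj M). Qed.

Lemma sym_letter_not_blank a : sym_letter a != sym_blank.
Proof. by apply/eqP => -[] /eqP; rewrite (negPf (letter_not_blank M a)). Qed.

Definition sym_val (s : sym) : A := if s is inl a then a else bl.

Local Notation ctl := (control N0 q Q).

Definition keep (r : I -> A) (i : I) : A * move := (r i, Stay).
Definition at_input (r : I -> A) (am : A * move) (i : I) : A * move :=
  if i == i0 then am else (r i, Stay).
Definition advice (o : option bool) : A := letter M (Advice o).

(* [h] is read on the history tape, whose head stays on the first cell beyond the
   history, and [b] on the budget tape. Once [Count] is over, the latter carries
   one tick per variable that an advice string may reveal, in the cells
   [0, .., m - 1], and its head is in cell [j - 1] when [j] more variables may be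
   revealed. [Init] and [Count] write these ticks, [Count] with the help of a
   counter modulo [q + 1]; meanwhile the history tape counts the variables, for
   [Fill]. [Next] is a step of an odometer whose last digit is the least
   significant. *)
Definition delta (s : ctl) (r : I -> A) (h b : sym) :
    ctl * (I -> A * move) * (sym * move) * (sym * move) :=
  let K := keep r in let H := (h, Stay) in let B := (b, Stay) in
  let x := r i0 in
  match s with
  | Init k => if (k < N0)%N then (Init _ _ (inord k.+1), K, H, (tick, MoveRight))
              else (Count _ _ ord0, K, H, B)
  | Count k =>
      if x == letter M Tick then
        (Count _ _ (inord (k.+1 %% q.+1)), at_input r (x, MoveRight),
         (tick, MoveRight), if k == ord0 then (tick, MoveRight) else B)
      else (Skip _ _ _, K, (h, MoveLeft), (b, MoveLeft))
  | Skip => if x == bl then (Fill _ _ _, K, H, B)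
            else (Skip _ _ _, at_input r (x, MoveRight), H, B)
  | Fill => if h == tick then
              (Fill _ _ _, at_input r (advice None, MoveRight),
               (sym_blank, MoveLeft), B)
            else (Return _ _ _, at_input r (x, MoveLeft), (h, MoveRight), B)
  | Return => if x == bl then
                (Run _ _ (start M), at_input r (x, MoveRight), H, B)
              else (Return _ _ _, at_input r (x, MoveLeft), H, B)
  | Run p => if verdict p is Some _ then (Undo1 _ _ _, K, H, B) else
             let pa := transition p (finfun r) in
             (Run _ _ pa.1, pa.2 : I -> A * move,
              (inr (p, finfun r), MoveRight), B)
  (* The step [p, r'] is undone by moving the heads back, then restoring [r']. *)
  | Undo1 => (Undo2 _ _ _, K, (h, MoveLeft), B)
  | Undo2 => if h is inr (p, r') then
               (Undo3 _ _ _, fun i => (r i, back ((transition p r').2 i).2), H, B)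
             else (Walk _ _ _, K, (h, MoveRight), B)
  | Undo3 => if h is inr (p, r') then
               (Undo1 _ _ _, fun i => (r' i, Stay), (sym_blank, Stay), B)
             else (Fail _ _ _, K, H, B)
  | Walk => if x == bl then (Next _ _ _, at_input r (x, MoveLeft), H, B)
            else (Walk _ _ _, at_input r (x, MoveRight), H, B)
  | Next => if x == advice None then
              if b == tick then
                (Return _ _ _, at_input r (advice (Some true), Stay), H,
                 (b, MoveLeft))
              else (Next _ _ _, at_input r (x, MoveLeft), H, B)
            else if x == advice (Some true) then
              (Return _ _ _, at_input r (advice (Some false), Stay), H, B)
            else if x == advice (Some false) then
              (Next _ _ _, at_input r (advice None, MoveLeft), H, (b, MoveRight))
            else (Fail _ _ _, K, H, B)
  | Fail => (Fail _ _ _, K, H, B)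
  end.

(** A rejecting run of [M] settles only one advice string, so it does not halt the search. *)
Definition search_verdict (s : ctl) : option bool :=
  match s with
  | Run p => if verdict p == Some true then Some true else None
  | Fail => Some false
  | _ => None
  end.

Definition search : TM := {|
  state := ctl;
  start := Init _ _ ord0;
  verdict := search_verdict;
  tape_index := (I + bool)%type;
  input_tape := inl i0;
  tape_symbol := sym;
  blank := sym_blank;
  letter := sym_letter;
  letter_inj := sym_letter_inj;
  letter_not_blank := sym_letter_not_blank;
  transition := fun s r =>
    let d := delta s (fun i => sym_val (r (inl i))) (r (inr true)) (r (inr false)) in
    (d.1.1.1, [ffun i => match i with
                         | inl i => (inl (d.1.1.2 i).1, (d.1.1.2 i).2)
                         | inr true => d.1.2
                         | inr false => d.2
                         end])
|}.

(** * Configurations of the search machine with absolute head positions *)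

Record snapshot : Type := Snapshot {
  ctl_of : ctl;
  tapes_of : I -> head_tape A;
  hist_of : head_tape sym;
  budget_of : head_tape sym
}.

Definition sstep (a : snapshot) : snapshot :=
  if search_verdict (ctl_of a) is Some _ then a else
  let d := delta (ctl_of a) (fun i => read (tapes_of a i))
             (read (hist_of a)) (read (budget_of a)) in
  Snapshot d.1.1.1 (fun i => act (d.1.1.2 i) (tapes_of a i))
    (act d.1.2 (hist_of a)) (act d.2 (budget_of a)).

Definition lift_tape (X : head_tape A) : head_tape sym :=
  (fun z => inl (X.1 z), X.2).

Definition shows (c : config search) (a : snapshot) : Prop :=
  [/\ cur_state c = ctl_of a,
      forall i, denotes sym_blank (cur_tapes c (inl i)) (lift_tape (tapes_of a i)),
      denotes sym_blank (cur_tapes c (inr true)) (hist_of a) &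
      denotes sym_blank (cur_tapes c (inr false)) (budget_of a)].

Lemma shows_step c a : shows c a -> shows (step c) (sstep a).
Proof.
case=> e dT dH dB; rewrite /step /sstep /= e.
case: (search_verdict _) => [b|].
  by split.
have -> : (fun i => sym_val ([ffun i1 => under_head (cur_tapes c i1)] (inl i))) =
          (fun i => read (tapes_of a i)).
  by apply/funext => i; rewrite ffunE (denotes_read (dT i)).
rewrite !ffunE (denotes_read dH) (denotes_read dB).
set d := delta _ _ _ _.
split=> //= [i||]; rewrite !ffunE; [|exact: denotes_act..].
have -> : lift_tape (act (d.1.1.2 i) (tapes_of a i)) =
          act (inl (d.1.1.2 i).1, (d.1.1.2 i).2) (lift_tape (tapes_of a i)).
  congr pair; apply/funext => z; rewrite /upd /=.
  by rewrite /upd; case: eqP.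
exact: denotes_act.
Qed.

Lemma shows_iter k c a : shows c a -> shows (iter k (@step search) c) (iter k sstep a).
Proof. by move=> ca; elim: k => //= k; apply: shows_step. Qed.

Definition reaches (k : nat) (a b : snapshot) : Prop :=
  exists2 t, (t <= k)%N & iter t sstep a = b.

Definition answers (k : nat) (a : snapshot) (v : bool) : Prop :=
  exists2 t, (t <= k)%N & search_verdict (ctl_of (iter t sstep a)) = Some v.

Lemma reaches_refl k a : reaches k a a.
Proof. by exists 0%N. Qed.

Lemma reaches_trans l m k a b c :
  reaches l a b -> reaches m b c -> (l + m <= k)%N -> reaches k a c.
Proof.
move=> [t tl <-] [u um <-] lmk; exists (u + t)%N; last by rewrite iterD.
lia.
Qed.

Lemma reaches_step k a c : reaches k (sstep a) c -> reaches k.+1 a c.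
Proof. by case=> t tk <-; exists t.+1 => //; rewrite iterSr. Qed.

Lemma reaches_le l k a b : reaches l a b -> (l <= k)%N -> reaches k a b.
Proof. by case=> t tl <- lk; exists t => //; apply: leq_trans lk. Qed.

Lemma reaches_answers l m k a b v :
  reaches l a b -> answers m b v -> (l + m <= k)%N -> answers k a v.
Proof.
move=> [t tl <-] [u um e] lmk; exists (u + t)%N; last by rewrite iterD.
lia.
Qed.

Lemma answers_le l k a v : answers l a v -> (l <= k)%N -> answers k a v.
Proof. by case=> t tl e lk; exists t => //; apply: leq_trans lk. Qed.

(** * Running the given machine and undoing the run *)

Definition mconf : Type := (Q * (I -> head_tape A))%type.

Definition mstep (c : mconf) : mconf :=
  if verdict c.1 is Some _ then c else
  let pa := transition c.1 [ffun i => read (c.2 i)] in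
  (pa.1, fun i => act (pa.2 i) (c.2 i)).

Definition mshows (c : config M) (a : mconf) : Prop :=
  cur_state c = a.1 /\ forall i, denotes bl (cur_tapes c i) (a.2 i).

Lemma mshows_step c a : mshows c a -> mshows (step c) (mstep a).
Proof.
case=> e dT; rewrite /step /mstep e.
case: (verdict _) => [b|]; first by split.
have -> : [ffun i => under_head (cur_tapes c i)] = [ffun i => read (a.2 i)].
  by apply/ffunP => i; rewrite !ffunE (denotes_read (dT i)).
by split=> //= i; rewrite ffunE; apply: denotes_act.
Qed.

Lemma mshows_iter k c a : mshows c a -> mshows (iter k (@step M) c) (iter k mstep a).
Proof. by move=> ca; elim: k => //= k; apply: mshows_step. Qed.

Lemma iter_mstep_halted k c b : verdict c.1 = Some b -> iter k mstep c = c.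
Proof. by move=> e; elim: k => //= k ->; rewrite /mstep e. Qed.

Lemma run_accept k p T H B :
  verdict (iter k mstep (p, T)).1 = Some true ->
  answers k (Snapshot (Run _ _ p) T H B) true.
Proof.
elim: k p T H => [|k IH] p T H /=.
  by move=> e; exists 0%N; rewrite //= e.
rewrite -iterS iterSr.
case e: (verdict p) => [b|].
  rewrite (@iter_mstep_halted _ _ b) /mstep /= e //= e => -[eb].
  by exists 0%N; rewrite //= e eb.
rewrite /mstep /= e /= => /IH {}IH.
have [t tk et] := IH (act (inr (p, [ffun i => read (T i)]), MoveRight) H).
exists t.+1 => //; rewrite iterSr /sstep /= e /=.
by rewrite act_stay.
Qed.

Lemma keepT (T : I -> head_tape A) :
  (fun i => act (keep (fun j => read (T j)) i) (T i)) = T.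
Proof. by apply/funext => i; rewrite act_stay. Qed.

(* The induction nests the undoing of the first step around the run and the
   undoing of the others, so that no invariant on the whole history is needed. *)
Lemma run_undo k p T (f : int -> sym) (h : int) B :
  (forall z, h <= z -> f z = sym_blank) ->
  verdict (iter k mstep (p, T)).1 = Some false ->
  reaches (4 * k).+1 (Snapshot (Run _ _ p) T (f, h) B)
    (Snapshot (Undo1 _ _ _) T (f, h) B).
Proof.
elim: k p T f h => [|k IH] p T f h fh.
  rewrite /= => e; apply: reaches_step.
  rewrite /sstep /= e /= keepT !act_stay; exact: reaches_refl.
rewrite iterSr.
case e: (verdict p) => [b|].
  rewrite (@iter_mstep_halted _ _ b) /mstep /= e //= e => -[eb].
  subst b; apply: reaches_step.
  by rewrite /sstep /= e /= keepT !act_stay; exact: reaches_refl.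
rewrite /mstep /= e /= => /IH {}IH.
set r := [ffun i => read (T i)] in IH *.
pose T' i := act ((transition p r).2 i) (T i).
pose f' : int -> sym := upd h (inr (p, r)) f.
have f'h z : h + 1 <= z -> f' z = sym_blank.
  by move=> hz; rewrite /f' /upd; case: eqP => [|_]; [lia | apply: fh; lia].
have step1 : reaches 1 (Snapshot (Run _ _ p) T (f, h) B)
     (Snapshot (Run _ _ (transition p r).1) T' (f', h + 1) B).
  by apply: reaches_step; rewrite /sstep /= e /= act_stay; exact: reaches_refl.
have undo : reaches 3 (Snapshot (Undo1 _ _ _) T' (f', h + 1) B)
     (Snapshot (Undo1 _ _ _) T (f, h) B).
  apply: reaches_step; rewrite /sstep /= keepT (act_keep MoveLeft (f', h + 1)).
  rewrite act_stay /= addrK.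
  have rf' : read (f', h) = inr (p, r) by rewrite /read /f' /upd /= eqxx.
  apply: reaches_step; rewrite /sstep /= rf' /= -{1}rf' !act_stay.
  apply: reaches_step; rewrite /sstep /= rf' /= act_stay.
  exists 0%N => //=; congr Snapshot.
    apply/funext => i; rewrite -[RHS](undo_act ((transition p r).2 i).1
      ((transition p r).2 i).2 (T i)) -surjective_pairing /T' /r !ffunE //.
  (* Blanking the history cell restores [f], which is blank at [h] by [fh]. *)
  rewrite /act /= addr0; congr pair; apply/funext => z; rewrite /f' /upd /=.
  by case: eqP => // ->; rewrite fh.
(* One forward step and three undo steps frame the [4 * k + 1] steps of the induction hypothesis. *)
apply: reaches_trans step1 (reaches_trans (IH _ _ f'h) undo (leqnn _)) _.
lia.
Qed.

End Search.

(** * Runs of the search machine *)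

(* The number of advice strings of length [k] that reveal at most [j] variables. *)
Fixpoint leaves (k j : nat) : nat :=
  if k is k'.+1 then
    (leaves k' j + if j is j'.+1 then 2 * leaves k' j' else 0)%N
  else 1%N.

Lemma leaves_gt0 k j : (0 < leaves k j)%N.
Proof. by elim: k j => //= k IH j; rewrite ltn_addr. Qed.

Definition weight (s : seq (option bool)) : nat := count isSome s.

Definition is_advice (a : symbol) : bool := if a is Advice _ then true else false.

Section SearchRun.
Context (M : TM) (N0 q n : nat) (v : seq symbol).

Local Notation I := (tape_index M).
Local Notation i0 := (input_tape M).
Local Notation A := (tape_symbol M).
Local Notation bl := (blank M).
Local Notation Sym := (sym M).
Local Notation sbl := (sym_blank M).
Local Notation tk := (tick M).
Local Notation lt := (@letter M).
Local Notation adv := (advice M).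
Local Notation snap := (@Snapshot M N0 q).
Local Notation reach := (@reaches M N0 q).
Local Notation answ := (@answers M N0 q).

Definition prefix_word : seq symbol := nseq n Tick ++ v.
Local Notation pre := prefix_word.

Definition advised_word (s : seq (option bool)) : seq symbol :=
  pre ++ [seq Advice o | o <- s].

(** [head_v] makes [Count] stop after exactly [n] ticks; [pre_not_advice] lets [Next] notice that it
    has left the advice. *)
Context (head_v : forall v', v <> Tick :: v').
Context (pre_not_advice : ~~ has is_advice pre).

(** The quotient is the ceiling of [i / (q + 1)]. For [i < n] this is the number of ticks on the
    budget tape once [Count] has read [i] variables; at [n] it is the whole budget. *)
Definition quota (i : nat) : nat := (N0 + (i + q) %/ q.+1)%N.
Local Notation m := (quota n).

Definition advised_cells (s : seq (option bool)) : seq A :=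
  map lt (advised_word s).
Local Notation W := advised_cells.

Lemma size_W s : size (W s) = (size pre + size s)%N.
Proof. by rewrite size_map size_cat size_map. Qed.

Lemma W_cat s1 o s2 : W (s1 ++ o :: s2) = W s1 ++ adv o :: map adv s2.
Proof. by rewrite /W /advised_word !map_cat /= -!map_comp catA. Qed.

Lemma W_pre : W [::] = map lt pre.
Proof. by rewrite /W /advised_word cats0. Qed.

Lemma W_not_blank s k : (k < size (W s))%N -> nth bl (W s) k != bl.
Proof.
rewrite size_map => lk; rewrite (nth_map Tick) //.
exact: letter_not_blank.
Qed.

Lemma adv_inj : injective adv.
Proof. by move=> a b /(@letter_inj M) []. Qed.

Definition input_only (X : head_tape A) (i : I) : head_tape A :=
  if i == i0 then X else (fun=> bl, 0).

Definition empty_tape : head_tape Sym := (fun=> sbl, 0).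

Definition scene st s (p : int) H (B : head_tape Sym) : snapshot M N0 q :=
  snap st (input_only (word_cells bl (W s), p)) H B.

Lemma input_onlyE X : input_only X i0 = X.
Proof. by rewrite /input_only eqxx. Qed.

Lemma act_at_input am X :
  (fun i => act (at_input (fun j => read (input_only X j)) am i) (input_only X i)) =
  input_only (act am X).
Proof.
apply/funext => i; rewrite /at_input /input_only.
by case: eqP => // _; rewrite act_stay.
Qed.

Lemma read_word (w : seq A) (k : nat) : read (word_cells bl w, k%:Z) = nth bl w k.
Proof. by []. Qed.

Lemma read_word_left (w : seq A) : read (word_cells bl w, - 1) = bl.
Proof. by []. Qed.

Lemma act_word mv (w : seq A) (p : int) :
  act (read (word_cells bl w, p), mv) (word_cells bl w, p) =
  (word_cells bl w, p + shift mv).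
Proof. by rewrite act_keep. Qed.

Lemma tick_neq_blank : (sbl == tk) = false.
Proof. by apply/negbTE; rewrite eq_sym sym_letter_not_blank. Qed.

Lemma reach_return s k H B : (k <= size (W s))%N ->
  reach k.+1 (scene (Return _ _ _) s (k%:Z - 1) H B)
    (scene (Run _ _ (start M)) s 0 H B).
Proof.
elim: k => [|k IH] lk; apply: reaches_step; rewrite /sstep /= input_onlyE.
  rewrite sub0r read_word_left eqxx /= act_at_input !act_stay.
  rewrite -(read_word_left (W s)) act_word addrC /=.
  exact: reaches_refl.
have -> : Posz k.+1 - 1 = k by lia.
rewrite read_word (negPf (W_not_blank lk)) /= act_at_input !act_stay.
rewrite -read_word act_word; apply: IH.
exact: ltnW.
Qed.

Lemma reach_walk s k H B : (k <= size (W s))%N ->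
  reach (size (W s) - k).+1 (scene (Walk _ _ _) s k H B)
    (scene (Next _ _ _) s ((size (W s))%:Z - 1) H B).
Proof.
move=> lk; move e : (size (W s) - k)%N => d.
elim: d k lk e => [|d IH] k lk e; apply: reaches_step; rewrite /sstep /= input_onlyE.
  have -> : k = size (W s) by lia.
  rewrite read_word nth_default // eqxx /= act_at_input !act_stay.
  rewrite -[X in (X, MoveLeft)](nth_default bl (leqnn (size (W s)))) -read_word.
  rewrite act_word.
  exact: reaches_refl.
have lk' : (k < size (W s))%N by lia.
rewrite read_word (negPf (W_not_blank lk')) /= act_at_input !act_stay.
rewrite -read_word act_word /=.
have -> : Posz k + 1 = k.+1 by lia.
apply: IH; lia.
Qed.

Context (tau : nat).
Context (halts : forall s, size s = n ->
  answer_within M (advised_word s) tau <> None).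

Definition successful (s : seq (option bool)) : Prop :=
  answer_within M (advised_word s) tau = Some true.

Lemma verdict_run s :
  verdict (iter tau (@mstep M) (start M, input_only (word_cells bl (W s), 0))).1 =
  answer_within M (advised_word s) tau.
Proof.
rewrite /answer_within; congr verdict; apply/esym.
suff /(mshows_iter tau) [] : mshows (init_config M (advised_word s))
    (start M, input_only (word_cells bl (W s), 0)) by [].
split=> // i; rewrite ffunE /= /input_only; case: eqP => _.
  exact: denotes_load.
by rewrite -(word_cells_nil bl); apply: denotes_load.
Qed.

(** Running and undoing take [4 * tau + 1] steps, noticing the empty history 2, and walking to the
    end of the input [size pre + n + 1]. *)
Definition leaf_cost : nat := (4 * tau + (size pre + n) + 4)%N.

Lemma reach_leaf s B : size s = n ->
  (successful s /\
     answ leaf_cost (scene (Run _ _ (start M)) s 0 empty_tape B) true) \/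
  (~ successful s /\
     reach leaf_cost (scene (Run _ _ (start M)) s 0 empty_tape B)
       (scene (Next _ _ _) s ((size (W s))%:Z - 1) empty_tape B)).
Proof.
move=> sz; rewrite /successful; have := verdict_run s.
case e: answer_within (halts sz) => [[]|] // _ ev; [left|right]; split => //.
  apply: answers_le (run_accept N0 q empty_tape B ev) _.
  by rewrite /leaf_cost; lia.
apply: (reaches_trans (run_undo N0 q B _ ev) (l := (4 * tau).+1)) => //.
  (* The history is empty again: [Undo2] finds a blank in cell [-1] instead of an entry and passes
     to [Walk]. *)
  apply: reaches_step; rewrite /sstep /= keepT act_keep act_stay /=.
  apply: reaches_step; rewrite /sstep /= keepT act_keep act_stay /=.
  rewrite sub0r addNr.
  exact: reach_walk.
by rewrite size_W sz /leaf_cost; lia.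
Qed.

(** * The odometer on advice strings *)

Definition budget (j : nat) : head_tape Sym := (pile sbl tk m, j%:Z - 1).

Lemma read_budget j : (j <= m)%N -> read (budget j) = if j is 0 then sbl else tk.
Proof.
move=> lj; rewrite /read /= pileE; case: j lj => [|j] lj //.
have -> : Posz j.+1 - 1 = j by lia.
by rewrite ltz_nat lj.
Qed.

Definition cursor (s : seq (option bool)) : int := (size pre + size s)%N.

Lemma read_cursor s1 o s2 :
  read (word_cells bl (W (s1 ++ o :: s2)), cursor s1) = adv o.
Proof. by rewrite W_cat /read /= nth_cat -size_W ltnn subnn. Qed.

Lemma write_cursor mv s1 o o' s2 :
  act (adv o', mv) (word_cells bl (W (s1 ++ o :: s2)), cursor s1) =
  (word_cells bl (W (s1 ++ o' :: s2)), cursor s1 + shift mv).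
Proof. by rewrite /act /= !W_cat /cursor -size_W upd_word_cells. Qed.

Lemma adv_eq o o' : (adv o == adv o') = (o == o').
Proof. exact: inj_eq adv_inj _ _. Qed.

(** A digit runs through [None], [Some true], [Some false]. Leaving [None] costs one unit, and
    returning to it refunds the unit. Payments only move the head of the budget tape; its ticks are
    never erased. *)
Lemma next_spend s1 s2 H j : (j < m)%N ->
  sstep (scene (Next _ _ _) (s1 ++ None :: s2) (cursor s1) H (budget j.+1)) =
  scene (Return _ _ _) (s1 ++ Some true :: s2) (cursor s1) H (budget j).
Proof.
move=> lj; rewrite /sstep /= input_onlyE read_cursor eqxx read_budget //.
rewrite eqxx /= act_at_input act_stay write_cursor addr0.
rewrite -[tk](read_budget (j := j.+1)) // act_keep /=.
by have -> : Posz j.+1 - 1 - 1 = j%:Z - 1 by lia.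
Qed.

Lemma next_broke s1 s2 H :
  sstep (scene (Next _ _ _) (s1 ++ None :: s2) (cursor s1) H (budget 0)) =
  scene (Next _ _ _) (s1 ++ None :: s2) (cursor s1 - 1) H (budget 0).
Proof.
rewrite /sstep /= input_onlyE read_cursor eqxx read_budget //.
rewrite tick_neq_blank /= act_at_input act_stay write_cursor.
by rewrite -[sbl](read_budget (j := 0)) // act_stay.
Qed.

Lemma next_flip s1 s2 H B :
  sstep (scene (Next _ _ _) (s1 ++ Some true :: s2) (cursor s1) H B) =
  scene (Return _ _ _) (s1 ++ Some false :: s2) (cursor s1) H B.
Proof.
rewrite /sstep /= input_onlyE read_cursor !adv_eq /=.
by rewrite act_at_input !act_stay write_cursor addr0.
Qed.

Lemma next_refund s1 s2 H j :
  sstep (scene (Next _ _ _) (s1 ++ Some false :: s2) (cursor s1) H (budget j)) =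
  scene (Next _ _ _) (s1 ++ None :: s2) (cursor s1 - 1) H (budget j.+1).
Proof.
rewrite /sstep /= input_onlyE read_cursor !adv_eq /=.
rewrite act_at_input act_stay write_cursor act_keep /=.
by have -> : Posz j - 1 + 1 = Posz j.+1 - 1 by lia.
Qed.

Lemma reach_restart s1 o s2 H B : size (s1 ++ o :: s2) = n ->
  reach (size pre + n).+1 (scene (Return _ _ _) (s1 ++ o :: s2) (cursor s1) H B)
    (scene (Run _ _ (start M)) (s1 ++ o :: s2) 0 H B).
Proof.
rewrite size_cat /= => sz.
have -> : cursor s1 = (size pre + size s1).+1%:Z - 1 by rewrite /cursor; lia.
apply: reaches_le (reach_return _ _ _) _; rewrite ?size_W ?size_cat /=; lia.
Qed.

(** Each leaf of the search tree pays for its own run and, at every level above it, for one return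
    to the start of the input; this also covers the steps of the odometer. *)
Definition level_cost (k : nat) : nat := (leaf_cost + k * (size pre + n + 2))%N.

(** Induction over the ternary tree of advice strings. A failed subtree is left with its digits back
    to [None], the budget restored and the other tapes clean, the head one cell to the left of its
    digits, so that subtrees can be searched one after the other. *)
Lemma explore k s j : (size s + k = n)%N -> (j <= m)%N ->
  let from := scene (Run _ _ (start M)) (s ++ nseq k None) 0 empty_tape (budget j) in
  let cost := (leaves k j * level_cost k)%N in
  ((exists s', [/\ size s' = k, (weight s' <= j)%N & successful (s ++ s')]) /\
     answ cost from true) \/
  ((forall s', size s' = k -> (weight s' <= j)%N -> ~ successful (s ++ s')) /\
     reach cost from
       (scene (Next _ _ _) (s ++ nseq k None) (cursor s - 1) empty_tape (budget j))).
Proof.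
elim: k s j => [|k IH] s j sz lj /=.
  rewrite cats0 mul1n /level_cost mul0n addn0.
  have sn : size s = n by lia.
  case: (reach_leaf (budget j) sn) => -[ss r]; [left|right]; split=> //.
  - by exists [::]; rewrite cats0.
  - by move=> s' /size0nil ->; rewrite cats0.
  - by move: r; rewrite size_W.
have cursor_rcons o : cursor (rcons s o) - 1 = cursor s.
  by rewrite /cursor size_rcons; lia.
have szr o : (size (rcons s o) + k = n)%N by rewrite size_rcons; lia.
have szc o : size (s ++ o :: nseq k None) = n.
  by rewrite size_cat /= size_nseq; lia.
set c := level_cost k.
have cS : level_cost k.+1 = (c + (size pre + n + 2))%N.
  by rewrite /c /level_cost mulSn; lia.
have wcons s' o : weight (o :: s') = (isSome o + weight s')%N by [].
case: (IH (rcons s None) j (szr _) lj) => -[ex1 r1].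
  left; split.
    by have [s' [ss' ws' su]] := ex1; exists (None :: s'); rewrite -cat_rcons /= ss'.
  move: r1; rewrite cat_rcons => /answers_le; apply; rewrite cS.
  by apply: leq_mul; rewrite ?leq_addr.
move: r1; rewrite cat_rcons cursor_rcons => r1.
have fail1 s' : size s' = k -> (weight s' <= j)%N -> ~ successful (s ++ None :: s').
  by rewrite -cat_rcons; apply: ex1.
have := leaves_gt0 k j.
case: j lj r1 fail1 {ex1} => [|j] lj r1 fail1 lgt.
  (* Without budget [None] is the only branch, and the odometer carries to the left. *)
  right; split=> [[//|o s'] [ss'] ws'|].
    by case: o ws' => // ws'; apply: fail1.
  apply: (reaches_trans r1 (m := 1)).
    by apply: reaches_step; rewrite next_broke; exact: reaches_refl.
  by rewrite addn0 cS -/c; nia.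
have lj' : (j <= m)%N by exact: ltnW.
(* Revealing the digit costs one unit, so the two remaining branches are searched with budget
   [j]. *)
have r2 := reaches_trans (k := (leaves k j.+1 * c + (size pre + n + 2))%N) r1.
have {}r2 : reach (leaves k j.+1 * c + (size pre + n + 2))%N
   (scene (Run _ _ (start M)) (s ++ None :: nseq k None) 0 empty_tape (budget j.+1))
   (scene (Run _ _ (start M)) (s ++ Some true :: nseq k None) 0 empty_tape (budget j)).
  apply: r2; first by apply: reaches_step; rewrite next_spend //; apply: reach_restart.
  by lia.
case: (IH (rcons s (Some true)) j (szr _) lj') => -[ex2 r3].
  left; split.
    have [s' [ss' ws' su]] := ex2; exists (Some true :: s'); split=> /=.
    - by rewrite ss'.
    - exact: ws'.
    - by rewrite -cat_rcons.
  move: r3; rewrite cat_rcons => r3; apply: (reaches_answers r2 r3).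
  by rewrite cS -/c; nia.
move: r3; rewrite cat_rcons cursor_rcons => r3.
have r4 : reach (leaves k j * c + (size pre + n + 2))%N
   (scene (Run _ _ (start M)) (s ++ Some true :: nseq k None) 0 empty_tape (budget j))
   (scene (Run _ _ (start M)) (s ++ Some false :: nseq k None) 0 empty_tape (budget j)).
  apply: reaches_trans r3 _ _; last by apply: leqnn.
  rewrite addnS; apply: reaches_step; rewrite next_flip.
  by apply: reaches_le (reach_restart _ _ _) _; rewrite ?addn1.
have r5 := reaches_trans r2 r4 (leqnn _).
case: (IH (rcons s (Some false)) j (szr _) lj') => -[ex3 r6].
  left; split.
    have [s' [ss' ws' su]] := ex3; exists (Some false :: s'); split=> /=.
    - by rewrite ss'.
    - exact: ws'.
    - by rewrite -cat_rcons.
  move: r6; rewrite cat_rcons => r6; apply: (reaches_answers r5 r6).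
  by rewrite cS -/c; have := leaves_gt0 k j; nia.
right; split.
  case=> [//|[[]|] s'] [ss']; rewrite wcons => ws'.
  - by rewrite -cat_rcons; apply: ex2.
  - by rewrite -cat_rcons; apply: ex3.
  - by apply: fail1.
move: r6; rewrite cat_rcons cursor_rcons => r6.
have r7 := reaches_trans r5 r6 (leqnn _).
apply: (reaches_trans r7 (m := 1)).
  by apply: reaches_step; rewrite next_refund; exact: reaches_refl.
by rewrite cS -/c; have := leaves_gt0 k j; nia.
Qed.

(** * Writing the budget and the initial advice *)

Lemma reach_init k : (k <= N0)%N ->
  reach (N0 - k).+1
    (scene (Init _ _ (inord k)) [::] 0 empty_tape (pile sbl tk k, k%:Z))
    (scene (Count _ _ ord0) [::] 0 empty_tape (pile sbl tk N0, N0%:Z)).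
Proof.
move=> lk; move e : (N0 - k)%N => d.
elim: d k lk e => [|d IH] k lk e; apply: reaches_step; rewrite /sstep /= inordK //.
  have -> : k = N0 by lia.
  rewrite ltnn /= keepT !act_stay; exact: reaches_refl.
have lk' : (k < N0)%N by lia.
rewrite lk' /= keepT act_stay /act /= upd_pile.
have -> : Posz k + 1 = k.+1 by lia.
apply: IH; lia.
Qed.

(** The ceiling grows just after a multiple of [q + 1], which is when the counter of [Count] is
    zero. *)
Lemma quotaS i : quota i.+1 = (quota i + (q.+1 %| i))%N.
Proof.
rewrite /quota addSn divnS // -addnS dvdn_addl //; lia.
Qed.

Lemma read_count_tick i : (i < n)%N -> nth bl (W [::]) i = lt Tick.
Proof.
move=> li; rewrite W_pre (nth_map Tick) ?size_cat ?size_nseq ?ltn_addr //.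
by rewrite nth_cat size_nseq li nth_nseq li.
Qed.

Lemma read_count_end : (nth bl (W [::]) n == lt Tick) = false.
Proof.
apply/eqP; rewrite W_pre map_cat nth_cat size_map size_nseq ltnn subnn.
case: v head_v => [|a v'] hv /= e.
  by have := letter_not_blank M Tick; rewrite -e eqxx.
by apply: (hv v'); rewrite (letter_inj e).
Qed.

Lemma reach_count i : (i <= n)%N ->
  reach (n - i).+1
    (scene (Count _ _ (inord (i %% q.+1))) [::] i (pile sbl tk i, i%:Z)
       (pile sbl tk (quota i), (quota i)%:Z))
    (scene (Skip _ _ _) [::] n (pile sbl tk n, n%:Z - 1) (budget m)).
Proof.
move=> li; move e : (n - i)%N => d.
elim: d i li e => [|d IH] i li e; apply: reaches_step; rewrite /sstep /= input_onlyE.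
  have -> : i = n by lia.
  rewrite read_word read_count_end /= keepT !act_keep; exact: reaches_refl.
have li' : (i < n)%N by lia.
rewrite read_word read_count_tick // eqxx /= act_at_input.
rewrite -(read_count_tick li') -read_word act_word /= [act (tk, _) _]/act /=.
rewrite upd_pile.
have -> : Posz i + 1 = i.+1 by lia.
set B := act _ _.
have -> : B = (pile sbl tk (quota i.+1), (quota i.+1)%:Z).
  rewrite /B quotaS /dvdn -val_eqE /= inordK ?ltn_pmod //.
  case: eqP => _; last by rewrite act_stay addn0.
  by rewrite /act /= upd_pile addn1; congr pair; lia.
rewrite inordK ?ltn_pmod // -[X in (X %% _)%N]addn1 modnDml addn1.
apply: IH; lia.
Qed.

Lemma reach_skip k H B : (k <= size pre)%N ->
  reach (size pre - k).+1 (scene (Skip _ _ _) [::] k H B)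
    (scene (Fill _ _ _) [::] (size pre) H B).
Proof.
have sW : size (W [::]) = size pre by rewrite size_W addn0.
move=> lk; move e : (size pre - k)%N => d.
elim: d k lk e => [|d IH] k lk e; apply: reaches_step; rewrite /sstep /= input_onlyE.
  have -> : k = size pre by lia.
  rewrite read_word nth_default ?sW // eqxx /= keepT !act_stay; exact: reaches_refl.
have lk' : (k < size (W [::]))%N by rewrite sW; lia.
rewrite read_word (negPf (W_not_blank lk')) /= act_at_input !act_stay.
rewrite -read_word act_word /=.
have -> : Posz k + 1 = k.+1 by lia.
apply: IH; lia.
Qed.

Lemma W_rcons s o : W (rcons s o) = rcons (W s) (adv o).
Proof. by rewrite -!cats1 W_cat. Qed.

(** Each tick on the history tape is exchanged for one [None], so exactly [n] are written and the
    history starts out blank. *)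
Lemma reach_fill i B : (i <= n)%N ->
  reach (n - i).+1
    (scene (Fill _ _ _) (nseq i None) (size pre + i)%N
       (pile sbl tk (n - i), (n - i)%N%:Z - 1) B)
    (scene (Return _ _ _) (nseq n None) ((size pre + n)%N%:Z - 1) empty_tape B).
Proof.
move=> li; move e : (n - i)%N => d.
elim: d i li e => [|d IH] i li e; apply: reaches_step; rewrite /sstep /=.
  have -> : i = n by lia.
  have r0 : read (pile sbl tk 0, 0%:Z - 1) = sbl by [].
  rewrite r0 tick_neq_blank /= act_at_input input_onlyE act_word act_stay.
  rewrite -{1}r0 act_keep /= addrNK /pile word_cells_nil; exact: reaches_refl.
have -> : Posz d.+1 - 1 = d by lia.
have rd : read (pile sbl tk d.+1, d%:Z) = tk.
  by rewrite [LHS]pileE ltz_nat ltnSn.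
rewrite rd eqxx /= act_at_input act_stay.
rewrite [act (sbl, _) _]/act /= upd_pile_pop.
rewrite [act (adv None, _) _]/act /=.
have -> : Posz (size pre + i) = size (W (nseq i None)) by rewrite size_W size_nseq.
rewrite upd_word_cells_end -W_rcons -[rcons _ _]/(rcons (nseq i None) None).
have -> : rcons (nseq i None) None = nseq i.+1 (None : option bool).
  by rewrite -cats1 cat_nseq -[[:: None]]/(nseq 1 None) /ncons -iterD addn1.
have -> : Posz (size (W (nseq i None))) + 1 = (size pre + i.+1)%N.
  by rewrite size_W size_nseq; lia.
apply: IH; lia.
Qed.

(** A carry out of the first digit reaches the last letter of the formula, or the blank cell [-1] if
    the prefix is empty; neither is an advice letter. *)
Lemma next_fail s H B :
  sstep (scene (Next _ _ _) s (cursor [::] - 1) H B) =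
  scene (Fail _ _ _) s (cursor [::] - 1) H B.
Proof.
rewrite /sstep /= input_onlyE.
have no o : (read (word_cells bl (W s), cursor [::] - 1) == adv o) = false.
  apply/eqP; rewrite /cursor addn0; case e: (size pre) => [|k].
    rewrite sub0r read_word_left => /esym/eqP.
    by rewrite (negPf (letter_not_blank _ _)).
  have -> : Posz k.+1 - 1 = k by lia.
  have lk : (k < size pre)%N by rewrite e.
  rewrite read_word /W /advised_word map_cat nth_cat size_map lk.
  rewrite (nth_map Tick) // => /(@letter_inj M) ek.
  move/negP: pre_not_advice; apply.
  by apply/(has_nthP Tick); exists k; rewrite ?ek.
by rewrite !no /= keepT !act_stay.
Qed.

Definition search_cost : nat :=
  (N0 + 2 * n + 2 * size pre + 10 + leaves n m * level_cost n)%N.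

Lemma search_run :
  let from := scene (Init _ _ ord0) [::] 0 empty_tape empty_tape in
  ((exists s, [/\ size s = n, (weight s <= m)%N & successful s]) /\
     answ search_cost from true) \/
  ((forall s, size s = n -> (weight s <= m)%N -> ~ successful s) /\
     answ search_cost from false).
Proof.
move=> from.
have to_run : reach (N0 + 2 * n + 2 * size pre + 8)%N from
    (scene (Run _ _ (start M)) (nseq n None) 0 empty_tape (budget m)).
  have r1 := reach_init (leq0n N0).
  have i0E : inord 0 = ord0 :> 'I_N0.+1 by apply/val_inj; rewrite /= inordK.
  have p0 : (pile sbl tk 0, 0%:Z) = empty_tape by rewrite /pile word_cells_nil.
  rewrite i0E p0 in r1.
  have r2 := reach_count (leq0n n).
  have q0 : quota 0 = N0 by rewrite /quota add0n divn_small ?addn0.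
  have j0E : inord (0 %% q.+1) = ord0 :> 'I_q.+1.
    by apply/val_inj; rewrite /= mod0n inordK.
  rewrite q0 j0E p0 in r2.
  have lnp : (n <= size pre)%N by rewrite size_cat size_nseq leq_addr.
  have r3 := reach_skip (pile sbl tk n, n%:Z - 1) (budget m) lnp.
  have r4 := reach_fill (budget m) (leq0n n).
  rewrite subn0 addn0 in r4.
  have lW : (size pre + n <= size (W (nseq n None)))%N by rewrite size_W size_nseq.
  have r5 := reach_return empty_tape (budget m) lW.
  have r := reaches_trans r1 (reaches_trans r2 (reaches_trans r3 (reaches_trans r4 r5
    (leqnn _)) (leqnn _)) (leqnn _)) (leqnn _).
  by apply: reaches_le r _; lia.
case: (explore (k := n) (s := [::]) (j := m) erefl (leqnn _)) => -[ex r];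
    [left|right]; split=> //.
  by apply: reaches_answers to_run r _; rewrite /search_cost; lia.
apply: (reaches_answers (m := 1) (reaches_trans to_run r (leqnn _))).
  by exists 1%N => //; rewrite [iter _ _ _]/= next_fail.
by rewrite /search_cost; lia.
Qed.

(** * From snapshots back to the Turing machine *)

Lemma lift_word w :
  lift_tape (word_cells bl w, 0) = (word_cells sbl (map inl w), 0).
Proof.
congr pair; apply/funext => -[k|k] //=.
have [lk|lk] := ltnP k (size w); first by rewrite (nth_map bl).
by rewrite !nth_default ?size_map.
Qed.

Lemma answersP u a k b :
  shows (init_config (search M N0 q) u) a -> answ k a b ->
  answer_within (search M N0 q) u k = Some b.
Proof.
move=> sh [t lt_t ans].
have [e _ _ _] := shows_iter t sh.
rewrite /answer_within -(subnK lt_t) iterD.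
have halted l : iter l (@step (search M N0 q)) (iter t (@step _) (init_config _ u)) =
    iter t (@step _) (init_config _ u).
  by elim: l => //= l ->; rewrite {1}/step e [verdict _]ans.
by rewrite halted e.
Qed.

Lemma search_answer_within :
  exists2 b, answer_within (search M N0 q) pre search_cost = Some b &
    b <-> exists s, [/\ size s = n, (weight s <= m)%N & successful s].
Proof.
have sh : shows (init_config (search M N0 q) pre)
    (scene (Init _ _ ord0) [::] 0 empty_tape empty_tape).
  have blank_tape : denotes sbl (load_tape sbl [::]) empty_tape.
    by rewrite /empty_tape -(word_cells_nil sbl); apply: denotes_load.
  have inlE i : (inl i == inl i0 :> I + bool) = (i == i0) by [].
  split=> //= [i||]; rewrite ffunE //= inlE /input_only.
  case: eqP => _ //; rewrite lift_word W_pre -map_comp; exact: denotes_load.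
case: search_run => -[ex /(answersP sh) ans]; [exists true|exists false] => //.
by split=> // -[s [ss ws]] /(ex _ ss ws).
Qed.


End SearchRun.

(** * Size of the instances and number of runs *)

Definition clauses_part (n : nat) (phi : cnf n) : seq symbol :=
  flatten [seq encode_clause c | c <- phi].

Lemma clauses_part_head n (phi : cnf n) v' : clauses_part phi <> Tick :: v'.
Proof. by case: phi. Qed.

Lemma has_flatten_map (T U : Type) (a : pred U) (f : T -> seq U) s :
  has a (flatten [seq f x | x <- s]) = has (fun x => has a (f x)) s.
Proof. by elim: s => //= x s <-; rewrite has_cat. Qed.

Lemma encode_cnf_not_advice n (phi : cnf n) : ~~ has is_advice (encode_cnf phi).
Proof.
rewrite has_cat has_nseq andbF /= has_flatten_map.
elim: phi => //= c phi IH; rewrite negb_or {}IH andbT has_flatten_map.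
by elim: c => //= l c IH; rewrite has_nseq andbF.
Qed.

Lemma size_encode_clause n (c : clause n) :
  (size c <= 3)%N -> (size (encode_clause c) <= (3 * n).+1)%N.
Proof.
move=> c3; rewrite /= ltnS.
apply: (@leq_trans (size c * n)%N); last by rewrite leq_mul2r c3 orbT.
elim: c {c3} => //= l c IH; rewrite size_cat size_nseq mulSn -addSn leq_add //.
Qed.

Lemma size_clauses_part n (phi : cnf n) :
  all (fun c : clause n => (size c <= 3)%N) phi ->
  (size (clauses_part phi) <= size phi * (3 * n).+1)%N.
Proof.
rewrite /clauses_part; elim: phi => //= c phi IH /andP[c3 /IH {}IH].
rewrite size_cat -addSn [leqRHS]mulSn; apply: leq_add => //.
exact: size_encode_clause.
Qed.

(** A clause of at most 3 literals is determined by its three optional entries, and no clause is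
    listed twice; there are [2 * n + 1] choices per entry. *)
Lemma size_3cnf n (phi : cnf n) : is_3cnf phi -> (size phi <= (2 * n).+1 ^ 3)%N.
Proof.
case/andP=> uphi /allP phi3.
pose f (c : clause n) : {ffun 'I_3 -> option (literal n)} :=
  [ffun i : 'I_3 => onth c i].
have fi : {in phi &, injective f}.
  move=> c d /phi3 c3 /phi3 d3 /ffunP e.
  have o k : onth c k = onth d k.
    have [k3|k3] := ltnP k 3; first by have := e (Ordinal k3); rewrite !ffunE.
    by rewrite !onth_default // (leq_trans _ k3).
  exact: eq_from_onth.
have <- : #|{ffun 'I_3 -> option (literal n)}| = ((2 * n).+1 ^ 3)%N.
  by rewrite card_ffun card_option card_prod card_ord card_bool mulnC card_ord.
rewrite -(size_map f) -(card_uniqP _) ?max_card //.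
by rewrite map_inj_in_uniq.
Qed.

Lemma size_encode_3cnf n (phi : cnf n) :
  is_3cnf phi -> ((size (encode_cnf phi) + n).+1 <= 40 * n.+1 ^ 4)%N.
Proof.
move=> phi3; have s := size_3cnf phi3; case/andP: phi3 => _ /size_clauses_part.
rewrite size_cat size_nseq /clauses_part => le.
(* The clauses then take at most [24 * n.+1 ^ 4] letters, and [2 * n + 1] remains to be added; 40 is
   generous. *)
have le8 : (size phi <= 8 * n.+1 ^ 3)%N.
  apply: leq_trans s _; rewrite -(expnMn 2 _ 3) leq_exp2r //; lia.
have : (n.+1 <= n.+1 ^ 3 * n.+1)%N by rewrite leq_pmull // expn_gt0.
rewrite [(n.+1 ^ 4)%N]expnSr.
have : (size phi * (3 * n).+1 <= 8 * n.+1 ^ 3 * (3 * n.+1))%N.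
  by apply: leq_mul => //; lia.
move: (size (flatten _)) (size phi * _)%N (n.+1 ^ 3)%N le => a b c le; nia.
Qed.

Definition advice_seq n (S : {set 'I_n}) (x : assignment n) : seq (option bool) :=
  [seq (if i \in S then Some (x i) else None) | i <- enum 'I_n].

Lemma size_advice_seq n (S : {set 'I_n}) x : size (advice_seq S x) = n.
Proof. by rewrite size_map size_enum_ord. Qed.

Lemma weight_advice_seq n (S : {set 'I_n}) x : weight (advice_seq S x) = #|S|.
Proof.
rewrite /weight count_map -sum1_count big_enum_cond -sum1_card.
by apply: eq_bigl => i /=; case: ifP.
Qed.

Lemma advised_word_advice_seq n (phi : cnf n) (S : {set 'I_n}) (x : assignment n) :
  advised_word n (clauses_part phi) (advice_seq S x) =
  encode_cnf phi ++ encode_advice S x.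
Proof. by rewrite /advised_word -map_comp. Qed.

(** Needed for soundness: a string tried by the search need not come from a satisfying assignment,
    but it is the advice of some assignment, and on an unsatisfiable formula all of these are
    rejected. *)
Lemma advice_seq_surj n (s : seq (option bool)) :
  size s = n -> exists S x, advice_seq (n := n) S x = s.
Proof.
move=> sz; exists [set i : 'I_n | isSome (nth None s i)].
exists [ffun i : 'I_n => nth None s i == Some true].
rewrite -[RHS](mkseq_nth None) /mkseq sz -val_enum_ord -map_comp.
apply: eq_map => i; rewrite /= inE ffunE.
by case: (nth _ _ _) => [[]|].
Qed.

(** * Growth estimates and the tail bound for the random subset *)

Section Estimates.
Context {R : realType}.
Implicit Types (eps z b delta : R).

(** For [X = 2 ^ r], the bound [X ^ j * (1 + 2 / X) ^ k] satisfies the recurrence of [leaves] with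
    equality when the budget is positive. *)
Lemma leaves_le r k j :
  (leaves k j)%:R <= (2 ^+ r) ^+ j * (1 + 2 * (2 ^+ r)^-1) ^+ k :> R.
Proof.
have r0 : 0 < 2 ^+ r :> R by rewrite exprn_gt0.
elim: k j => [|k IH] j.
  rewrite expr0 mulr1 /= -exprM; apply: exprn_ege1; lra.
set a : R := 1 + 2 * _.
have a0 : 0 <= a by rewrite /a addr_ge0 // mulr_ge0 // invr_ge0 ltW.
case: j => [|j].
  rewrite [leaves _ _]/= addn0 (le_trans (IH 0%N)) // !expr0 !mul1r.
  by apply: ler_weXn2l => //; rewrite /a lerDl mulr_ge0 // invr_ge0 ltW.
rewrite [leaves _ _]/= natrD natrM exprSr.
have -> : (2 ^+ r) ^+ j * 2 ^+ r * a ^+ k.+1 =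
    (2 ^+ r) ^+ j.+1 * a ^+ k + 2 * ((2 ^+ r) ^+ j * a ^+ k).
  rewrite [a ^+ k.+1]exprSr {2}/a mulrDr mulr1 mulrDr exprSr; congr (_ + _).
  by field; rewrite gt_eqF.
by apply: lerD; [exact: IH | rewrite ler_pM2l].
Qed.

(** By convexity, the power lies below its chord over the interval from 0 to 1. *)
Lemma expr_1D_le eps k : 0 <= eps <= 1 -> (1 + eps) ^+ k <= 1 + (2 ^+ k - 1) * eps.
Proof.
move=> /andP[e0 e1]; elim: k => [|k IH]; first by rewrite !expr0; lra.
rewrite exprS; apply: le_trans (ler_wpM2l _ IH) _; first lra.
have : 1 <= 2 ^+ k :> R by apply: exprn_ege1; lra.
rewrite [2 ^+ k.+1]exprS; move: (2 ^+ k) => t t1.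
have : 0 <= (t - 1) * eps * (1 - eps) by rewrite !mulr_ge0 //; lra.
nra.
Qed.

Lemma bernoulli_le b k : 1 <= b -> 1 + k%:R * (b - 1) <= b ^+ k.
Proof.
move=> b1; elim: k => [|k IH]; first by rewrite expr0; lra.
rewrite exprS; apply: le_trans (ler_wpM2l _ IH); last lra.
rewrite -natr1; have : 0 <= k%:R * (b - 1) * (b - 1) by rewrite !mulr_ge0 //; lra.
by nra.
Qed.

Lemma powR2_gt1 delta : 0 < delta -> 1 < 2 `^ delta :> R.
Proof.
move=> d0; have {1}<- : 1 `^ delta = 1 :> R by rewrite powR1.
by apply: gt0_ltr_powR; rewrite // ?nnegrE; lra.
Qed.

Lemma powR2_nat delta n : 2 `^ (delta * n%:R) = (2 `^ delta) ^+ n :> R.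
Proof. by rewrite powRrM powR_mulrn // powR_ge0. Qed.

(** Bernoulli's inequality bounds [n + 1] by [K * b ^ n]; raising this to the power [e + 1] turns
    [b] into [2 ^ delta]. Using [e + 1] avoids a division by zero. *)
Lemma poly_le_exp delta e : 0 < delta ->
  exists2 K : R, 0 <= K & forall n : nat, n.+1%:R ^+ e <= K * 2 `^ (delta * n%:R).
Proof.
move=> d0; pose b : R := 2 `^ (delta / e.+1%:R).
have b1 : 1 < b by apply: powR2_gt1; rewrite divr_gt0.
have h0 : 0 < b - 1 by lra.
pose K := 1 + (b - 1)^-1.
have K0 : 0 <= K by rewrite addr_ge0 // invr_ge0 ltW.
exists (K ^+ e.+1); first exact: exprn_ge0.
move=> n.
have be : b ^+ e.+1 = 2 `^ delta.
  by rewrite /b -powR_mulrn ?powR_ge0 // -powRrM divfK // pnatr_eq0.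
rewrite powR2_nat -be -exprM mulnC exprM -exprMn.
apply: (@le_trans _ _ (n.+1%:R ^+ e.+1)).
  by apply: ler_weXn2l => //; rewrite ler1n.
rewrite lerXn2r ?nnegrE ?ler0n ?mulr_ge0 ?exprn_ge0 //; first lra.
apply: (@le_trans _ _ (K * (1 + n%:R * (b - 1)))); last first.
  by rewrite ler_wpM2l // bernoulli_le // ltW.
rewrite /K -natr1.
have -> : (1 + (b - 1)^-1) * (1 + n%:R * (b - 1)) =
   1 + n%:R * (b - 1) + (b - 1)^-1 + n%:R by field; rewrite gt_eqF.
have := mulr_ge0 (ler0n R n) (ltW h0).
have : 0 <= (b - 1)^-1 by rewrite invr_ge0 ltW.
lra.
Qed.

(** Markov's inequality for [2 ^ #|S|]. The quota has [N0] units beyond the ceiling of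
    [n / (q + 1)], and the latter absorb the expectation [(1 + eps) ^ n]. *)
Lemma subset_prob_le eps N0 q n (E : {set 'I_n} -> Prop) :
  0 <= eps <= 1 -> (1 + eps) ^+ q.+1 <= 2 ->
  (forall S, E S -> (quota N0 q n <= #|S|)%N) ->
  subset_prob eps E <= (2 ^+ N0)^-1.
Proof.
move=> /andP[e0 e1] eq2 ES; set m := quota N0 q n.
pose w (S : {set 'I_n}) : R := \prod_(i < n) (if i \in S then eps else 1 - eps).
have w0 S : 0 <= w S by apply: prodr_ge0 => i _; case: ifP; lra.
have m0 : 0 < 2 ^+ m :> R by rewrite exprn_gt0.
have le1 : subset_prob eps E <= (2 ^+ m)^-1 * \sum_(S : {set 'I_n}) 2 ^+ #|S| * w S.
  rewrite mulr_sumr [leRHS](bigID (fun S => `[< E S >])) /=.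
  apply: (@le_trans _ _ (\sum_(S : {set 'I_n} | `[< E S >])
      (2 ^+ m)^-1 * (2 ^+ #|S| * w S))).
    apply: ler_sum => S /asboolP /ES mS.
    rewrite mulrA ler_peMl ?w0 // [leRHS]mulrC ler_pdivlMr // mul1r.
    by apply: ler_weXn2l => //; lra.
  rewrite lerDl; apply: sumr_ge0 => S _.
  by rewrite !mulr_ge0 // ?invr_ge0 ?exprn_ge0.
have sumE : \sum_(S : {set 'I_n}) 2 ^+ #|S| * w S = (1 + eps) ^+ n.
  have -> : (1 + eps) ^+ n = \prod_(i < n) (2 * eps + (1 - eps)).
    by rewrite prodr_const card_ord; congr (_ ^+ _); ring.
  (* Expanding the product chooses for each variable between membership, of weight [2 * eps], and
     absence, of weight [1 - eps]. *)
  rewrite bigA_distr; apply: eq_bigr => S _.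
  have -> : 2 ^+ #|S| = \prod_(i < n) (if i \in S then 2 else 1) :> R.
    by rewrite -big_mkcond prodr_const.
  rewrite /w -big_split /=; apply: eq_bigr => i _.
  by case: ifP; rewrite ?mul1r.
apply: le_trans le1 _; rewrite sumE.
rewrite ler_pdivrMl // ler_pdivlMr ?exprn_gt0 // /m /quota exprD mulrC.
rewrite ler_pM2l ?exprn_gt0 //.
set a := ((n + q) %/ q.+1)%N.
have na : (n <= q.+1 * a)%N.
  have := divn_eq (n + q) q.+1; have := ltn_pmod (n + q) (ltn0Sn q).
  by rewrite -/a; lia.
apply: (@le_trans _ _ ((1 + eps) ^+ (q.+1 * a))).
  by apply: ler_weXn2l => //; lra.
by rewrite exprM lerXn2r ?nnegrE ?exprn_ge0 //; lra.
Qed.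

End Estimates.

(** * Hardness *)

Lemma answer_within_mono M w t t' b :
  (t <= t')%N -> answer_within M w t = Some b -> answer_within M w t' = Some b.
Proof.
move=> /subnK <-; rewrite /answer_within iterD => e.
suff -> : forall l c, verdict (cur_state c) = Some b -> iter l (@step M) c = c by [].
by move=> l c ec; elim: l => //= l ->; rewrite /step ec.
Qed.

Lemma answer_within_inj M w t t' b b' :
  answer_within M w t = Some b -> answer_within M w t' = Some b' -> b = b'.
Proof.
case/orP: (leq_total t t') => le e e'.
  by move: e'; rewrite (answer_within_mono le e) => -[].
by move: e; rewrite (answer_within_mono le e') => -[].
Qed.

(** [P] is one more than the length of an advised input, so [c * P ^ k] bounds one run of [M]; the
    extra factor [P ^ 2] pays for scanning the input at each of the [n] levels. *)
Lemma search_cost_le c k N0 q n v P :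
  P = (size (prefix_word n v) + n).+1 ->
  (search_cost N0 q n v (c * P ^ k) <=
   leaves n (quota N0 q n) * ((N0 + 4 * c + 20) * P ^ k.+2))%N.
Proof.
rewrite /search_cost /level_cost /leaf_cost.
have := leaves_gt0 n (quota N0 q n); set L := leaves _ _ => L0.
move: (size (prefix_word n v)) => x defP.
have X : (P ^ k.+2 = P ^ k * (P * P))%N by rewrite !expnSr mulnA.
have P1 : (1 <= P ^ k)%N by rewrite expn_gt0 defP.
rewrite X; move: (P ^ k)%N P1 => Y Y1.
have PP : (x + n < P * P)%N by nia.
have nP : (n * (x + n + 2) <= 2 * (P * P))%N by nia.
have h1 : (P * P <= Y * (P * P))%N by rewrite leq_pmull.
have h2 : (c * Y <= c * (Y * (P * P)))%N by rewrite leq_mul2l leq_pmulr ?orbT //; lia.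
set Z := (Y * (P * P))%N in h1 h2 *.
have h3 : (N0 * 1 <= N0 * Z)%N by rewrite leq_mul2l (leq_trans _ h1) ?orbT //; lia.
have : (N0 + 2 * n + 2 * x + 10 + (4 * (c * Y) + (x + n) + 4 + n * (x + n + 2)) <=
        (N0 + 4 * c + 20) * Z)%N.
  by nia.
move: (_ * Z)%N (4 * _ + _ + _ + _)%N => U V UV; nia.
Qed.

Section Hardness.
Context {R : realType}.

Lemma exists_expr_ge (b x : R) : 1 < b -> exists k : nat, x <= b ^+ k.
Proof.
move=> b1; have h0 : 0 < b - 1 by lra.
exists (Num.bound (`|x| / (b - 1))).
apply: le_trans (bernoulli_le _ (ltW b1)).
have : `|x| / (b - 1) < (Num.bound (`|x| / (b - 1)))%:R.
  by apply: archi_boundP; rewrite divr_ge0 // ltW.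
rewrite ltr_pdivrMr // => lt.
have := ler_norm x; lra.
Qed.

(** One factor [b ^ n] comes from the budget, as [q + 1] times the ceiling of [n / (q + 1)] is at
    most [n + q]; the other bounds [(1 + 2 / 2 ^ r) ^ n]. *)
Lemma leaves_quota_le (b : R) r q N0 n :
  1 <= b -> 2 ^+ r <= b ^+ q.+1 -> 1 + 2 * (2 ^+ r)^-1 <= b ->
  (leaves n (quota N0 q n))%:R <= (2 ^+ r) ^+ N0 * b ^+ q * (b ^+ n * b ^+ n).
Proof.
move=> b1 rb ab; apply: le_trans (leaves_le r _ _) _.
have b0 : 0 <= b by lra.
have r0 : 0 < 2 ^+ r :> R by rewrite exprn_gt0.
rewrite mulrA; apply: ler_pM.
- by rewrite !exprn_ge0 // ltW.
- by rewrite exprn_ge0 // addr_ge0 // mulr_ge0 // invr_ge0 ltW.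
- rewrite /quota exprD -mulrA ler_pM2l ?exprn_gt0 //.
  apply: (@le_trans _ _ ((b ^+ q.+1) ^+ ((n + q) %/ q.+1))).
    by rewrite lerXn2r ?nnegrE ?exprn_ge0 // ltW.
  rewrite -exprM -exprD; apply: ler_weXn2l => //.
  by rewrite mulnC addnC leq_trunc_div // addnC.
- by rewrite lerXn2r ?nnegrE // addr_ge0 // mulr_ge0 // invr_ge0 ltW.
Qed.

Lemma search_solves (M : TM) (c k N0 q r : nat) (eps p delta : R) :
  (forall w, answer_within M w (c * (size w).+1 ^ k)%N <> None) ->
  solves_3sat_with_subset_advice eps p M ->
  0 <= eps <= 1 -> (1 + eps) ^+ q.+1 <= 2 -> (2 ^+ N0)^-1 < p ->
  0 < delta -> 2 ^+ r <= (2 `^ (delta / 4)) ^+ q.+1 ->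
  1 + 2 * (2 ^+ r)^-1 <= 2 `^ (delta / 4) ->
  solves_3sat_in_exp_time delta (search M N0 q).
Proof.
move=> poly solves eps01 eps2 pN0 d0 rb ab.
have d2 : 0 < delta / 2 by lra.
(* Half of the exponent is kept for the polynomial factor: [P] is at most [40 * n.+1 ^ 4] and enters
   with power [k + 2]. *)
have [K K0 polyK] := poly_le_exp (4 * k.+2) d2.
set b : R := 2 `^ (delta / 4) in rb ab.
pose D : R := (N0 + 4 * c + 20)%:R * 40%:R ^+ k.+2.
have D0 : 0 <= D by rewrite mulr_ge0 ?ler0n ?exprn_ge0.
exists ((2 ^+ r) ^+ N0 * b ^+ q * (D * K)) => n phi phi3.
pose v := clauses_part phi.
pose P := (size (encode_cnf phi) + n).+1.
pose tau := (c * P ^ k)%N.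
have halts s : size s = n -> answer_within M (advised_word n v s) tau <> None.
  move=> sz.
  have -> : tau = (c * (size (advised_word n v s)).+1 ^ k)%N.
    by rewrite size_cat size_map sz.
  exact: poly.
have [a ans aP] := search_answer_within N0 q (@clauses_part_head n phi)
  (encode_cnf_not_advice phi) halts.
exists (search_cost N0 q n v tau); split; last first.
  rewrite ans; congr Some; apply/idP/idP.
    move=> /aP[s [ss _ su]]; apply: contraT => unsat.
    have [S [x Sx]] := advice_seq_surj ss.
    have [t rej] := (solves n phi phi3).2 unsat S x.
    move: su; rewrite /successful -Sx advised_word_advice_seq => su.
    by have := answer_within_inj su rej.
  case/existsP => x satx; apply/aP; apply: contrapT => none.
  (* If no tried string succeeds, every accepted [S] exceeds the quota, and the success probability
     drops below [p]. *)
  have := (solves n phi phi3).1 x satx; apply/negP; rewrite -ltNge.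
  apply: le_lt_trans pN0; apply: (subset_prob_le eps01 eps2) => S [t acc].
  rewrite leqNgt; apply/negP => ltS; apply: none.
  exists (advice_seq S x); split; rewrite ?size_advice_seq ?weight_advice_seq //.
    exact: ltnW.
  rewrite /successful.
  (* [M] has answered by time [tau], and its answers at [t] and [tau] agree. *)
  case e: answer_within (halts _ (size_advice_seq S x)) => [b'|] // _.
  by move: e; rewrite advised_word_advice_seq => /(answer_within_inj acc) <-.
apply: (@le_trans _ _ ((leaves n (quota N0 q n))%:R * (D * (n.+1%:R ^+ (4 * k.+2))))).
  rewrite /D -[40%:R]/(40%N%:R) -!natrX -!natrM ler_nat.
  apply: leq_trans (search_cost_le c k N0 q erefl) _.
  rewrite leq_mul2l -mulnA leq_mul2l; apply/orP; right; apply/orP; right.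
  by rewrite expnM -expnMn leq_exp2r // size_encode_3cnf.
have -> : 2 `^ (delta * n%:R) = (b ^+ n * b ^+ n) * 2 `^ (delta / 2 * n%:R).
  rewrite /b -!powR2_nat -!powRD ?pnatr_eq0 ?implybT //; congr (_ `^ _); lra.
rewrite [leRHS]mulrACA; apply: ler_pM => //.
- by rewrite mulr_ge0 ?exprn_ge0 ?ler0n.
- by apply: leaves_quota_le => //; apply: ltW; apply: powR2_gt1; lra.
- by rewrite -[leRHS]mulrA ler_wpM2l.
Qed.

End Hardness.

Theorem mainTheorem4 (R : realType) (eth : ETH R) :
  exists eps0 : R, 0 < eps0 /\
    forall eps : R, 0 <= eps <= eps0 ->
      forall p : R, 0 < p ->
        ~ exists M : TM,
            polynomial_time M /\ solves_3sat_with_subset_advice eps p M.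
Proof.
have [delta [d0 hard]] := eth.
have b1 : 1 < 2 `^ (delta / 4) :> R by apply: powR2_gt1; lra.
set b : R := 2 `^ (delta / 4) in b1.
have h0 : 0 < b - 1 by lra.
have two1 : 1 < 2 :> R by lra.
(* [r] gives [1 + 2 / 2 ^ r <= b], then [q] gives [2 ^ r <= b ^ q]; both depend on [delta] alone. *)
have [r rh] := exists_expr_ge (2 / (b - 1)) two1.
have [q qr] := exists_expr_ge (2 ^+ r) b1.
have r0 : 0 < 2 ^+ r :> R by rewrite exprn_gt0.
have q0 : 0 < 2 ^+ q.+1 :> R by rewrite exprn_gt0.
(* By the chord bound, this makes [(1 + eps) ^ (q + 1)] at most 2, whatever [p] is. *)
exists (2 ^+ q.+1)^-1; split; first by rewrite invr_gt0.
move=> eps /andP[e0 e1] p p0 [M [[c [k poly]] solves]].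
have eps01 : 0 <= eps <= 1.
  rewrite e0 (le_trans e1) // invf_le1 // exprn_ege1 //; lra.
have eps2 : (1 + eps) ^+ q.+1 <= 2.
  apply: le_trans (expr_1D_le _ eps01) _.
  have : eps * 2 ^+ q.+1 <= 1 by rewrite -ler_pdivlMr // mul1r.
  nra.
(* The numerator 2 makes [2 ^ - N0 < p] strict. *)
have [N0 pN0] := exists_expr_ge (2 / p) two1.
apply: hard; exists (search M N0 q).
apply: (search_solves poly solves eps01 eps2 _ d0 (r := r)).
- rewrite invf_plt ?posrE ?exprn_gt0 //; apply: lt_le_trans pN0.
  by rewrite -[X in X < _]mul1r ltr_pM2r ?invr_gt0.
- apply: le_trans qr _; apply: ler_weXn2l => //; exact: ltW.
- rewrite -/b; move: rh; rewrite ler_pdivrMr // mulrC -ler_pdivrMr // => rh.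
  lra.
Qed.
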